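(* (a) For every integer $n\ge 6$ there exists a matrix in $\mathrm{COP}_n\setminus\bigcup_{r\in\mathbb N}\mathcal K_n^{(r)}$ all of whose diagonal entries belong to $\{0,1\}$. (b) For every integer $n\ge 7$ there exists a matrix in $\mathrm{COP}_n\setminus\bigcup_{r\in\mathbb N}\mathcal K_n^{(r)}$ all of whose diagonal entries are equal to $1$.
   Context: Let $\mathcal S^n$ be the space of real symmetric $n\times n$ matrices and $\mathbb N=\{0,1,2,\dots\}$. For $x\in\mathbb R^n$ put $x^{\circ 2}=(x_1^2,\dots,x_n^2)$. The copositive cone is $\mathrm{COP}_n=\{M\in\mathcal S^n: (x^{\circ 2})^TMx^{\circ 2}\ge 0 \text{ for all } x\in\mathbb R^n\}$. Let $\Sigma$ denote the set of finite sums of squares of real polynomials in $x_1,\dots,x_n$. For $r\in\mathbb N$, $\mathcal K_n^{(r)}=\{M\in\mathcal S^n: (\sum_{i=1}^n x_i^2)^r\,(x^{\circ 2})^TMx^{\circ 2}\in\Sigma\}$. *)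

(* Defs.v *)
From HB Require Import structures.
From mathcomp Require Import all_boot all_order all_algebra.
From mathcomp Require Import reals.
From mathcomp Require Import mpoly.

Set Implicit Arguments.
Unset Strict Implicit.
Unset Printing Implicit Defensive.

Import Order.TTheory GRing.Theory Num.Theory.
Local Open Scope ring_scope.

(* [vsq] and [qform] are stated over an arbitrary coefficient ring because they
   are used both at real vectors and at the vector of polynomial variables. *)
Definition vsq (A : comNzRingType) (n : nat) (x : 'cV[A]_n) : 'cV[A]_n :=
  \col_i (x i 0 ^+ 2).

Definition qform (A : comNzRingType) (n : nat) (M : 'M[A]_n) (v : 'cV[A]_n) : A :=
  (v^T *m M *m v) 0 0.

Definition COP (R : realType) (n : nat) (M : 'M[R]_n) : Prop :=
  M^T = M /\ forall x : 'cV[R]_n, 0 <= qform M (vsq x).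

(* The empty list is allowed, so 0 is a sum of squares. *)
Definition is_sos (R : realType) (n : nat) (p : {mpoly R[n]}) : Prop :=
  exists s : seq {mpoly R[n]}, p = \sum_(q <- s) q ^+ 2.

Definition mvars (R : realType) (n : nat) : 'cV[{mpoly R[n]}]_n := \col_i 'X_i.

Definition Kcone (R : realType) (n r : nat) (M : 'M[R]_n) : Prop :=
  M^T = M /\
  is_sos ((\sum_(i < n) 'X_i ^+ 2) ^+ r
          * qform (map_mx (@mpolyC n R) M) (vsq (mvars R n))).

(* Main.v *)
Require Import Defs.
From mathcomp Require Import all_boot all_order all_algebra.
From mathcomp Require Import reals.
From mathcomp Require Import mpoly.
From mathcomp Require Import ring.

(* Let [H] be the Horn matrix and [M = H (+) u u^T], which is copositive. Suppose
   that [u^T d^(o2) = 0] for some [d <> 0] and that [|x|^(2r)] times the form of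
   [M] is a sum of squares of polynomials [q_k]. At the points [(x, d Y)] this
   form is [H(x)], so comparing the coefficients of [Y^(2r)], the largest power
   that can occur, gives [|d|^(2r) H(x) = sum_k L_k(x)^2], where [L_k(x)] is the
   coefficient of [Y^r] in [q_k].
   On the plane spanned by [e_i] and [e_(i+1)] (indices mod 5) the Horn form is
   [(s^2 - t^2)^2], which forces [L_k(e_(i+1)) = - L_k(e_i)]. Since 5 is odd, all
   [L_k(e_i)] vanish, whereas [H(e_i) = 1].
   For (a) take [u = 0]; for (b) take [u = (1, -1, 1, -1, ...)] and
   [d = (1, 1, 0, ..., 0)]. *)

Set Implicit Arguments.
Unset Strict Implicit.
Unset Printing Implicit Defensive.

Import Order.TTheory GRing.Theory Num.Theory.
Local Open Scope ring_scope.

(** * Formally real rings and sums of squares *)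

(** The property behind the degree arguments; it passes to polynomial rings, so they can be iterated
    over [{poly R}] and [{poly {poly R}}]. *)
Definition formally_real (A : nzRingType) : Prop :=
  forall s : seq A, \sum_(a <- s) a ^+ 2 = 0 -> {in s, forall a, a = 0}.

Lemma formally_real_realDomain (R : realDomainType) : formally_real R.
Proof.
move=> s /eqP; rewrite psumr_eq0 => [/allP h a /h|a _]; last exact: sqr_ge0.
by rewrite sqrf_eq0 => /eqP.
Qed.

Lemma coef_sqr_top (A : comNzRingType) (p : {poly A}) (m : nat) :
  (size p <= m.+1)%N -> (p ^+ 2)`_m.*2 = p`_m ^+ 2.
Proof.
move=> hp; have hm : (m < m.*2.+1)%N by rewrite ltnS -addnn leq_addr.
have m2 : (m.*2 - m = m)%N by rewrite -addnn addnK.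
rewrite expr2 coefM (bigD1 (Ordinal hm)) //= m2 big1 ?addr0 //.
move=> i; rewrite -val_eqE /= => ne_im.
have [lt_im|le_mi] := ltnP i m.
  rewrite [p`_(_ - _)]nth_default ?mulr0 //; apply: leq_trans hp _.
  by rewrite ltn_subRL -[X in (_ < X)%N]addnn ltn_add2r.
rewrite nth_default ?mul0r //; apply: leq_trans hp _.
by rewrite ltn_neqAle eq_sym ne_im.
Qed.

(** Leading terms of squares cannot cancel: above the bound, the squares of the top coefficients sum
    to 0, so each of these vanishes. The excess [k] is lowered one step at a time. *)
Lemma sos_size_bound (A : comNzRingType) (s : seq {poly A}) (m : nat) :
  formally_real A -> (size (\sum_(p <- s) p ^+ 2)%R <= m.*2.+1)%N ->
  {in s, forall p : {poly A}, size p <= m.+1}%N.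
Proof.
move=> frA hP.
suff h k : {in s, forall p : {poly A}, size p <= m.+1 + k}%N ->
           {in s, forall p : {poly A}, size p <= m.+1}%N.
  apply: (h (\max_(p <- s) size p)%N) => p ps.
  by apply: leq_trans (leq_addl _ _); rewrite (big_rem p) //= leq_maxl.
elim: k => [|k IHk] hs; first by move=> p /hs; rewrite addn0.
apply: IHk => p ps.
have top0 : \sum_(a <- [seq q`_(m.+1 + k) | q : {poly A} <- s]) a ^+ 2 = 0.
  rewrite big_map -[RHS](nth_default 0 (n := (m.+1 + k).*2) (leq_trans hP _)).
    rewrite coef_sum big_seq [RHS]big_seq; apply: eq_bigr => q qs.
    by rewrite coef_sqr_top // -addnS; exact: hs.
  by rewrite doubleD doubleS; apply: leq_trans (leq_addr _ _); rewrite leqnSn.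
apply/leq_sizeP => j; rewrite leq_eqVlt => /predU1P[<-|hj].
  by apply: (frA _ top0); exact: map_f.
by apply: nth_default; apply: leq_trans (hs p ps) _; rewrite addnS.
Qed.

Lemma coef_sos_top (A : comNzRingType) (s : seq {poly A}) (m : nat) :
  formally_real A -> (size (\sum_(p <- s) p ^+ 2)%R <= m.*2.+1)%N ->
  (\sum_(p <- s) p ^+ 2)`_m.*2 = \sum_(p <- s) p`_m ^+ 2.
Proof.
move=> frA /(sos_size_bound frA) hs; rewrite coef_sum big_seq [RHS]big_seq.
by apply: eq_bigr => p /hs /coef_sqr_top.
Qed.

(** The size bound with [m = 0] makes every term of a vanishing sum constant, and the constants are
    handled in [A]. *)
Lemma formally_real_poly (A : comNzRingType) :
  formally_real A -> formally_real {poly A}.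
Proof.
move=> frA s s0 p ps.
have hs : (size (\sum_(q <- s) q ^+ 2)%R <= 0.*2.+1)%N by rewrite s0 size_poly0.
have h0 := coef_sos_top frA hs; rewrite s0 coef0 in h0.
rewrite [p]size1_polyC ?(sos_size_bound frA hs) //; apply/eqP.
rewrite polyC_eq0; apply/eqP; apply: (frA [seq q`_0 | q : {poly A} <- s]).
  by rewrite big_map -h0.
exact: map_f.
Qed.

(* A sum-of-squares decomposition of [c (t^2 - s^2)^2] can only use multiples of
   [t^2 - s^2], which take opposite values at [(s, t) = (1, 0)] and [(0, 1)].
   Here [t] is the outer and [s] the inner variable of [{poly {poly R}}]. *)
Lemma sos_sqr_difference (R : realDomainType) (c : R)
    (l : seq {poly {poly R}}) :
  \sum_(p <- l) p ^+ 2 = c%:P%:P * ('X^2 - ('X^2)%:P) ^+ 2 ->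
  {in l, forall p, p.[0].[1] = - p.[1].[0]}.
Proof.
move=> hl p pl.
have frR := @formally_real_realDomain R; have frP := formally_real_poly frR.
(* At [t = s] and [t = -s] the right-hand side vanishes, hence so does every [p]. *)
have root0 (a : {poly R}) : a ^+ 2 = 'X^2 -> p.[a] = 0.
  move=> ha; apply: (frP [seq q.[a] | q : {poly {poly R}} <- l]); last exact: map_f.
  have h : (\sum_(q <- l) q ^+ 2).[a] = 0.
    rewrite hl hornerM horner_exp hornerD hornerN hornerXn !hornerC ha subrr.
    by rewrite expr0n mulr0.
  by rewrite big_map -[RHS]h horner_sum; apply: eq_bigr => q _; rewrite horner_exp.
have dE : c%:P%:P * ('X^2 - ('X^2)%:P) ^+ 2
    = (c%:P%:P * 'X^4 - (c%:P * 'X^2 *+ 2)%:P * 'X^2 + (c%:P * 'X^4)%:P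
      : {poly {poly R}}).
  by rewrite !rmorphE /=; ring.
have hsz : (size (\sum_(q <- l) q ^+ 2)%R <= 2.*2.+1)%N.
  rewrite hl dE; apply/leq_sizeP => -[|[|[|[|[|j]]]]] // _.
  by rewrite coefD coefB !coefCM !coefXn coefC /= !mulr0 !addr0 subr0.
have szp := sos_size_bound frP hsz pl.
(* The coefficient of [t^4] is the constant [c], so the [t^2] coefficient of [p] cannot involve
   [s]. *)
have szc : (size (p`_2)%R <= 1)%N.
  have h4 := coef_sos_top frP hsz.
  pose l2 := [seq q`_2 | q : {poly {poly R}} <- l].
  apply: (sos_size_bound (m := 0) (s := l2) frR); last exact: map_f.
  rewrite big_map -h4 hl dE.
  rewrite coefD coefB !coefCM !coefXn coefC /= !mulr0 !addr0 subr0 mulr1.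
  exact: size_polyC_leq1.
have pE a : p.[a] = p`_0 + p`_1 * a + p`_2 * a ^+ 2.
  rewrite (horner_coef_wide _ szp) !big_ord_recl big_ord0 /= expr0 mulr1 expr1.
  by rewrite addr0 addrA.
have h1 := root0 'X erefl; have h2 := root0 (- 'X) (sqrrN _).
rewrite !pE in h1 h2 *; rewrite sqrrN in h2.
have b0 : p`_1 = 0.
  have : p`_1 * 'X *+ 2 = 0.
    have -> : p`_1 * 'X *+ 2 = (p`_0 + p`_1 * 'X + p`_2 * 'X^2)
                             - (p`_0 + p`_1 * - 'X + p`_2 * 'X^2) by ring.
    by rewrite h1 h2 subrr.
  (* Formal reality removes the factor 2: [a *+ 2 = 0] gives [a ^+ 2 + a ^+ 2 = 0]. *)
  move=> a2; have /eqP : p`_1 * 'X = 0.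
    apply: (frP [:: p`_1 * 'X; p`_1 * 'X]); last exact: mem_head.
    by rewrite !big_cons big_nil addr0 -mulr2n expr2 -mulrnAl a2 mul0r.
  by rewrite mulf_eq0 polyX_eq0 orbF => /eqP.
have aE : p`_0 = - (p`_2 * 'X^2).
  by move/eqP: h1; rewrite b0 mul0r addr0 addr_eq0 => /eqP.
rewrite b0 aE [p`_2](size1_polyC szc) !hornerE; ring.
Qed.

(** * Block forms and ring morphisms *)

Lemma qform_diag_block (A : comNzRingType) (p m : nat) (H : 'M[A]_p)
    (u : 'cV[A]_m) (x : 'cV[A]_p) (y : 'cV[A]_m) :
  qform (block_mx H 0 0 (u *m u^T)) (col_mx x y)
    = qform H x + ((u^T *m y) 0 0) ^+ 2.
Proof.
rewrite /qform tr_col_mx mul_row_block !mulmx0 addr0 add0r mul_row_col mxE.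
have -> : y^T *m (u *m u^T) *m y = (u^T *m y)^T *m (u^T *m y).
  by rewrite trmx_mul trmxK !mulmxA.
by rewrite [X in _ + X]mxE big_ord1 [(_^T) _ _]mxE -expr2 [ord0]ord1.
Qed.

Lemma vsq_col_mx (A : comNzRingType) (p m : nat) (x : 'cV[A]_p) (y : 'cV[A]_m) :
  vsq (col_mx x y) = col_mx (vsq x) (vsq y).
Proof. by apply/colP => i; rewrite !mxE; case: split => j; rewrite mxE. Qed.

Lemma map_qform (A B : comNzRingType) (f : {rmorphism A -> B}) (n : nat)
    (M : 'M[A]_n) (v : 'cV[A]_n) :
  f (qform M v) = qform (map_mx f M) (map_mx f v).
Proof. by rewrite /qform map_trmx -!map_mxM [RHS]mxE. Qed.

Lemma map_vsq (A B : comNzRingType) (f : {rmorphism A -> B}) (n : nat)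
    (v : 'cV[A]_n) :
  map_mx f (vsq v) = vsq (map_mx f v).
Proof. by apply/colP => i; rewrite !mxE rmorphXn. Qed.

(** * Evaluation at escaping points *)

Lemma mmap_comp (n : nat) (R A B : comNzRingType)
    (h : R -> A) (f : {rmorphism A -> B}) (v : 'I_n -> A) (q : {mpoly R[n]}) :
  f (mmap h v q) = mmap (f \o h) (f \o v) q.
Proof.
rewrite /mmap rmorph_sum; apply: eq_bigr => m _; rewrite rmorphM /mmap1.
by rewrite rmorph_prod; congr (_ * _); apply: eq_bigr => i _; rewrite rmorphXn.
Qed.

Lemma mmap_ext (n : nat) (R A : nzRingType) (h1 h2 : R -> A)
    (v1 v2 : 'I_n -> A) (q : {mpoly R[n]}) :
  h1 =1 h2 -> v1 =1 v2 -> mmap h1 v1 q = mmap h2 v2 q.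
Proof.
move=> hE vE; rewrite /mmap; apply: eq_bigr => m _; rewrite hE.
by rewrite (mmap1_eq _ vE).
Qed.

(* The block [u u^T] contributes nothing at the point [(x, d Y)], whose second
   part escapes to infinity with [Y]. *)
Definition escape_point (R A : comNzRingType) (h : R -> A) (p m : nat)
    (d : 'cV[R]_m) (x : 'cV[A]_p) : 'cV[{poly A}]_(p + m) :=
  col_mx (map_mx polyC x) (map_mx (fun a => (h a)%:P * 'X) d).

(** This is [L_k(x)] for [q = q_k]. The ring [A] is general so that [x] may have numeric or
    polynomial coordinates. *)
Definition escape_coef (R A : comNzRingType) (h : R -> A) (p m : nat)
    (d : 'cV[R]_m) (r : nat) (x : 'cV[A]_p) (q : {mpoly R[p + m]}) : A :=
  (mmap (polyC \o h) (fun j => escape_point h d x j 0) q)`_r.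

Lemma map_escape_coef (R A B : comNzRingType) (h : R -> A) (h' : R -> B)
    (f : {rmorphism A -> B}) (p m : nat) (d : 'cV[R]_m) (r : nat)
    (x : 'cV[A]_p) (q : {mpoly R[p + m]}) :
  f \o h =1 h' ->
  f (escape_coef h d r x q) = escape_coef h' d r (map_mx f x) q.
Proof.
move=> hE; rewrite /escape_coef -coef_map /= mmap_comp.
congr ((polyseq _)`_r); apply: mmap_ext.
  by move=> a /=; rewrite map_polyC -hE.
move=> j /=; rewrite !mxE; case: split => k; rewrite !mxE.
  by rewrite map_polyC.
by rewrite rmorphM /= map_polyC map_polyX -hE.
Qed.

(** The list [s] is chosen before [A], [h] and [x]: the same polynomials must serve on every edge of
    the Horn cycle, over [{poly {poly R}}] as well as over [R]. *)
Lemma sos_escape (R : realType) (p m r : nat) (H : 'M[R]_p) (u d : 'cV[R]_m) :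
  u^T *m vsq d = 0 -> Kcone r (block_mx H 0 0 (u *m u^T)) ->
  exists s : seq {mpoly R[p + m]},
    forall (A : comNzRingType) (h : {rmorphism R -> A}) (x : 'cV[A]_p),
      formally_real A ->
      \sum_(q <- s) escape_coef h d r x q ^+ 2
        = h (\sum_i d i 0 ^+ 2) ^+ r * qform (map_mx h H) (vsq x).
Proof.
move=> ud0 [_ [s sE]]; exists s => A h x frA.
pose v := escape_point h d x.
pose phi : {rmorphism {mpoly R[p + m]} -> {poly A}} :=
  mmap (polyC \o h) (fun j => v j 0).
have phiX j : phi 'X_j = v j 0 by rewrite /phi /= mmapX mmap1U.
have phiC a : phi a%:MP = (h a)%:P by rewrite /phi /= mmapC.
have phiU j : phi 'X_(lshift m j) = (x j 0)%:P by rewrite phiX /v col_mxEu mxE.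
have phiD j : phi 'X_(rshift p j) = (h (d j 0))%:P * 'X.
  by rewrite phiX /v col_mxEd mxE.
have phi_norm : phi (\sum_i 'X_i ^+ 2)
    = (\sum_i x i 0 ^+ 2)%:P + (h (\sum_i d i 0 ^+ 2))%:P * 'X^2.
  rewrite rmorph_sum big_split_ord /=; congr (_ + _).
    by rewrite rmorph_sum; apply: eq_bigr => i _; rewrite !rmorphXn phiU.
  rewrite !rmorph_sum mulr_suml; apply: eq_bigr => i _.
  by rewrite !rmorphXn phiD exprMn.
have phi_form : phi (qform (map_mx (@mpolyC (p + m) R)
      (block_mx H 0 0 (u *m u^T))) (vsq (mvars R (p + m))))
    = (qform (map_mx h H) (vsq x))%:P.
  rewrite map_qform map_vsq -map_mx_comp.
  have -> : map_mx phi (mvars R (p + m)) = v.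
    by apply/colP => j; rewrite [LHS]mxE [mvars _ _ _ _]mxE phiX.
  pose f : {rmorphism R -> {poly A}} := polyC \o h.
  have -> : map_mx (phi \o @mpolyC (p + m) R) (block_mx H 0 0 (u *m u^T))
      = map_mx f (block_mx H 0 0 (u *m u^T)).
    by apply/matrixP => i j; rewrite [LHS]mxE [RHS]mxE /= phiC.
  rewrite map_block_mx !map_mx0 map_mxM -map_trmx /v /escape_point
    vsq_col_mx qform_diag_block.
  (* The block [u u^T] contributes the square of ['X^2] times the image of [u^T *m vsq d], which is
     0. *)
  have -> : vsq (map_mx (fun a => (h a)%:P * 'X) d) = 'X^2 *: map_mx f (vsq d).
    by apply/colP => i; rewrite !mxE exprMn mulrC -!rmorphXn.
  rewrite -scalemxAr map_trmx -map_mxM ud0 map_mx0 scaler0 mxE expr0n addr0.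
  by rewrite [RHS]map_qform map_vsq map_mx_comp.
have phi_sos : \sum_(q <- s) phi q ^+ 2
    = ((\sum_i x i 0 ^+ 2)%:P + (h (\sum_i d i 0 ^+ 2))%:P * 'X^2) ^+ r
      * (qform (map_mx h H) (vsq x))%:P.
  rewrite -phi_norm -phi_form -rmorphXn -rmorphM sE rmorph_sum.
  by apply: eq_bigr => q _; rewrite rmorphXn.
set a := \sum_i x i 0 ^+ 2 in phi_sos.
set b := h _ in phi_sos *.
set c := qform _ _ in phi_sos *.
(* Stated through a size bound and a coefficient, since [b] may be 0. *)
have [szP topP] : (size ((a%:P + b%:P * 'X^2) ^+ r)%R <= r.*2.+1)%N /\
    ((a%:P + b%:P * 'X^2) ^+ r)`_r.*2 = b ^+ r.
  elim: {s sE phi_sos} r => [|k [szk topk]].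
    by rewrite !expr0 size_poly1 coefC.
  rewrite exprSr mulrDr; split.
    apply/leq_sizeP => j hj; rewrite coefD coefMC mulrA coefMXn coefMC.
    have hj' : (k.*2 < j)%N by apply: leq_trans hj; rewrite doubleS ltnS ltnW.
    rewrite nth_default ?(leq_trans szk) // mul0r add0r.
    case: ltnP => // _; rewrite nth_default ?mul0r // (leq_trans szk) //.
    by rewrite ltn_subRL addnC addn2.
  rewrite coefD coefMC mulrA coefMXn coefMC doubleS subn2 /= topk.
  by rewrite nth_default ?(leq_trans szk) // mul0r add0r exprSr.
have szs : (size (\sum_(q <- [seq phi q | q <- s]) q ^+ 2)%R <= r.*2.+1)%N.
  rewrite big_map phi_sos; apply/leq_sizeP => j hj.
  by rewrite coefMC nth_default ?mul0r //; apply: leq_trans szP hj.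
have := coef_sos_top frA szs.
by rewrite !big_map phi_sos coefMC topP => ->.
Qed.

(** * The Horn matrix and its copositivity *)

Definition horn (A : comNzRingType) : 'M[A]_5 :=
  \matrix_(i, j) if (j == ordS i) || (i == ordS j) then - 1 else 1.

Lemma tr_horn (A : comNzRingType) : (horn A)^T = horn A.
Proof. by apply/matrixP => i j; rewrite !mxE orbC. Qed.

Lemma map_horn (A B : comNzRingType) (h : {rmorphism A -> B}) :
  map_mx h (horn A) = horn B.
Proof.
by apply/matrixP => i j; rewrite !mxE; case: ifP; rewrite ?rmorphN rmorph1.
Qed.

(** The Horn matrix is the all-ones matrix minus twice the adjacency matrix of the 5-cycle; each
    edge counts twice, whence the 4. *)
Lemma qform_horn (A : comNzRingType) (y : 'cV[A]_5) :
  qform (horn A) y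
    = (\sum_i y i 0) ^+ 2 - (\sum_i y i 0 * y (ordS i) 0) *+ 4.
Proof.
pose e (b : bool) : A := b%:R *+ 2.
have hornE i j : horn A i j = 1 - e (j == ordS i) - e (i == ordS j).
  rewrite mxE /e; case: i j => [[|[|[|[|[|i]]]]] //= hi];
    move=> [[|[|[|[|[|j]]]]] //= hj]; ring.
have pick1 i : \sum_j y i 0 * e (j == ordS i) * y j 0
    = (y i 0 * y (ordS i) 0) *+ 2.
  rewrite (bigD1 (ordS i)) //= eqxx big1 => [|j /negPf->].
    by rewrite /e /=; ring.
  by rewrite /e /=; ring.
rewrite /qform mxE; under eq_bigr => j _ do rewrite mxE mulr_suml.
transitivity (\sum_j \sum_i (y i 0 * y j 0 - y i 0 * e (j == ordS i) * y j 0
                             - y j 0 * e (i == ordS j) * y i 0)).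
  apply: eq_bigr => j _; apply: eq_bigr => i _; rewrite mxE hornE; ring.
under eq_bigr => j _ do rewrite 2!sumrB pick1 -mulr_suml.
rewrite 2!sumrB -mulr_sumr -expr2 exchange_big /=.
by under [X in _ - X - _]eq_bigr => i _ do rewrite pick1; rewrite !sumrMnl; ring.
Qed.

Lemma sum_ord5 (V : nmodType) (F : 'I_5 -> V) :
  \sum_i F i = F (inord 0) + F (inord 1) + F (inord 2) + F (inord 3) + F (inord 4).
Proof.
rewrite !big_ord_recl big_ord0 addr0 !addrA.
by do ![congr (_ + _)]; congr F; apply: val_inj; rewrite /= inordK.
Qed.

(** Comparing two adjacent coordinates suffices: in each case the form is a square plus four times a
    sum of products of nonnegative terms. *)
Lemma qform_horn_ge0 (R : realDomainType) (y : 'cV[R]_5) :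
  (forall i, 0 <= y i 0) -> 0 <= qform (horn R) y.
Proof.
move=> y_ge0; rewrite qform_horn !sum_ord5.
have ordSE k : (k < 5)%N -> ordS (inord k : 'I_5) = inord (k.+1 %% 5).
  by move=> hk; apply: val_inj; rewrite /= !inordK // ltn_mod.
rewrite !ordSE // modnn !modn_small //.
move: (y_ge0 (inord 0)) (y_ge0 (inord 1)) (y_ge0 (inord 2)) (y_ge0 (inord 3)).
move: (y_ge0 (inord 4)).
move: (y _ 0) (y _ 0) (y _ 0) (y _ 0) (y _ 0) => d c b a e he ha hb hc hd.
have [le_de|le_ed] := lerP d e.
  have -> : (a + b + c + d + e) ^+ 2
      - (a * b + b * c + c * d + d * e + e * a) *+ 4
      = (a - b + c + d - e) ^+ 2 + (b * d + c * (e - d)) *+ 4 by ring.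
  by rewrite addr_ge0 ?sqr_ge0 // mulrn_wge0 // addr_ge0 // mulr_ge0 // subr_ge0.
have -> : (a + b + c + d + e) ^+ 2
    - (a * b + b * c + c * d + d * e + e * a) *+ 4
    = (a - b + c - d + e) ^+ 2 + (b * e + a * (d - e)) *+ 4 by ring.
rewrite addr_ge0 ?sqr_ge0 // mulrn_wge0 // addr_ge0 // mulr_ge0 // subr_ge0.
exact: ltW.
Qed.

Lemma COP_horn_block (R : realType) (m : nat) (u : 'cV[R]_m) :
  COP (block_mx (horn R) 0 0 (u *m u^T)).
Proof.
split=> [|x]; first by rewrite tr_block_mx tr_horn !trmx0 trmx_mul trmxK.
rewrite -[x]vsubmxK vsq_col_mx qform_diag_block addr_ge0 ?sqr_ge0 //.
by apply: qform_horn_ge0 => i; rewrite mxE sqr_ge0.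
Qed.

(** * Sign changes along the 5-cycle *)

Definition edge_point (A : comNzRingType) (s t : A) (i : 'I_5) : 'cV[A]_5 :=
  \col_j (if j == i then s else if j == ordS i then t else 0).

Lemma qform_horn_edge (A : comNzRingType) (s t : A) (i : 'I_5) :
  qform (horn A) (vsq (edge_point s t i)) = (t ^+ 2 - s ^+ 2) ^+ 2.
Proof.
rewrite qform_horn; case: i => [[|[|[|[|[|i]]]]] // hi];
  rewrite !big_ord_recl !big_ord0 !mxE -!val_eqE /=; ring.
Qed.

Theorem horn_block_notin_Kcone (R : realType) (m r : nat) (u d : 'cV[R]_m) :
  u^T *m vsq d = 0 -> d != 0 ->
  ~ Kcone r (block_mx (horn R) 0 0 (u *m u^T)).
Proof.
move=> ud0 d_neq0 /(sos_escape ud0)[l hl].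
have frR := @formally_real_realDomain R.
have frPP := formally_real_poly (formally_real_poly frR).
pose h : {rmorphism R -> {poly {poly R}}} := polyC \o polyC.
pose L i := escape_coef idfun d r (edge_point 1 0 i : 'cV[R]_5).
pose c := (\sum_i d i 0 ^+ 2) ^+ r.
have L_next q i : q \in l -> L i q = - L (ordS i) q.
  (* Generic point of the edge from [i] to [ordS i]: the inner variable is [s], the outer one
     [t]. *)
  move=> ql; pose P := escape_coef h d r (edge_point 'X%:P 'X i).
  have PE (a b : R) :
      (P q).[a%:P].[b] = escape_coef idfun d r (edge_point b a i) q.
    pose f : {rmorphism {poly {poly R}} -> R} :=
      horner_eval b \o horner_eval a%:P.
    rewrite -[LHS]/(f _) (map_escape_coef (h' := idfun)) => [|z].
      congr escape_coef; apply/colP => j; rewrite !mxE.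
      by rewrite !(fun_if f) rmorph0 /f /= /horner_eval !hornerE.
    by rewrite /= /horner_eval !hornerE.
  have PL : \sum_(p <- [seq P q | q <- l]) p ^+ 2
      = c%:P%:P * ('X^2 - ('X^2)%:P) ^+ 2.
    rewrite big_map hl // map_horn qform_horn_edge -!rmorphXn.
    by rewrite /c !rmorphXn.
  have := sos_sqr_difference PL (map_f P ql).
  have := PE 0 1; have := PE 1 0; rewrite polyC0 polyC1 /L => -> -> ->.
  (* The endpoint [(0, 1)] of edge [i] is the starting point of the next edge; this needs
     [ordS i != i]. *)
  congr (- escape_coef _ _ _ _ _).
  apply/colP => j; rewrite !mxE !if_same.
  by case: eqP => // ->; case: (i) => [[|[|[|[|[|k]]]]] // hk].
have L0 q i : q \in l -> L i q = 0.
  move=> ql; have : L i q = - L (iter 5 (@ordS _) i) q.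
    by do 5![rewrite L_next //]; rewrite !opprK.
  have -> : iter 5 (@ordS _) i = i.
    by case: i => [[|[|[|[|[|i]]]]] // hi]; apply: val_inj.
  by move/eqP; rewrite -addr_eq0 -mulr2n mulrn_eq0 => /eqP.
have c_neq0 : c != 0.
  rewrite expf_neq0 //; apply: contraNneq d_neq0 => /eqP.
  rewrite psumr_eq0 => [/allP h0|i _]; last exact: sqr_ge0.
  apply/eqP/colP => i; apply/eqP; rewrite mxE -sqrf_eq0.
  by apply: h0; rewrite mem_index_enum.
have := hl R idfun (edge_point 1 0 ord0) frR.
rewrite big_seq big1 => [/esym/eqP|q ql]; last first.
  by rewrite [escape_coef _ _ _ _ _]L0 // expr0n.
rewrite map_horn qform_horn_edge expr0n sub0r sqrrN !expr1n mulr1 /=.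
by rewrite (negPf c_neq0).
Qed.

(** * Diagonal entries and the two families *)

Lemma horn_block_diag (R : realType) (m : nat) (u : 'cV[R]_m) (i : 'I_(5 + m)) :
  (exists j, block_mx (horn R) 0 0 (u *m u^T) i i = u j 0 ^+ 2) \/
  block_mx (horn R) 0 0 (u *m u^T) i i = 1.
Proof.
rewrite -[i]splitK; case: (split i) => j; [right|left]; last first.
  by exists j; rewrite block_mxEdr mxE big_ord1 mxE -expr2.
rewrite block_mxEul mxE; case: j => [[|[|[|[|[|j]]]]] // hj].
Qed.

Theorem mainTheorem4 (R : realType) :
  (forall n : nat, (6 <= n)%N ->
     exists M : 'M[R]_n,
       [/\ COP M, ~ (exists r : nat, Kcone r M)
         & forall i : 'I_n, M i i = 0 \/ M i i = 1])
  /\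
  (forall n : nat, (7 <= n)%N ->
     exists M : 'M[R]_n,
       [/\ COP M, ~ (exists r : nat, Kcone r M)
         & forall i : 'I_n, M i i = 1]).
Proof.
split=> n hn.
  (* For [u = 0] every nonzero [d] is admissible, so one extra coordinate suffices. *)
  have -> : n = (5 + (n - 6).+1)%N by rewrite -addSnnS subnKC.
  pose u : 'cV[R]_(n - 6).+1 := 0.
  exists (block_mx (horn R) 0 0 (u *m u^T)); split; first exact: COP_horn_block.
    case=> r; apply: (horn_block_notin_Kcone (d := const_mx 1)).
      by rewrite /u trmx0 mul0mx.
    by apply/eqP => /colP/(_ ord0)/eqP; rewrite !mxE oner_eq0.
  move=> i; case: (horn_block_diag u i) => [[j ->]|->]; last by right.
  by left; rewrite mxE expr0n.
have -> : n = (5 + (n - 7).+2)%N by rewrite -!addSnnS subnKC.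
(* Entries of [u] must square to 1, so two coordinates of opposite sign are needed to cancel against
   [d]; hence [7 <= n]. *)
pose u : 'cV[R]_(n - 7).+2 := \col_i (-1) ^+ i.
exists (block_mx (horn R) 0 0 (u *m u^T)); split; first exact: COP_horn_block.
  case=> r; apply: (horn_block_notin_Kcone (d := \col_i (i < 2)%:R)).
    apply/matrixP => i j; rewrite mxE 2!big_ord_recl big1 => [|k _].
      by rewrite !mxE expr0 expr1 !expr1n; ring.
    by rewrite !mxE expr0n mulr0.
  by apply/eqP => /colP/(_ ord0)/eqP; rewrite !mxE oner_eq0.
by move=> i; case: (horn_block_diag u i) => [[j ->]|//]; rewrite mxE sqrr_sign.
Qed.
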